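(* Let $\kappa>0$ and let $\Phi$ be a strict error bound function that is logarithmic with exponent $\gamma>0$. Then there exists a constant $\eta>0$ such that $$\sqrt{(\Phi^\spadesuit_\kappa)^{-1}(-s)}\ \sim\ \eta\Big(\frac{1}{\ln(s)}\Big)^\gamma\quad\text{as }s\to\infty.$$ In particular, there are constants $\eta_1>0$, $\eta_2>0$ and $N>0$ such that $$\eta_1\Big(\frac{1}{\ln(s)}\Big)^\gamma\le\sqrt{(\Phi^\spadesuit_\kappa)^{-1}(-s)}\le\eta_2\Big(\frac{1}{\ln(s)}\Big)^\gamma\qquad\forall\,s\ge N.$$
   Context: ''Monotone increasing'' means strictly increasing. A strict error bound function is a function $\Phi:[0,\infty)\times[0,\infty)\to[0,\infty)$ such that: for every fixed $b\ge0$, $\Phi(\cdot,b)$ is monotone nondecreasing on $[0,\infty)$, right-continuous at $0$, and $\Phi(0,b)=0$; for every fixed $a\ge0$, $\Phi(a,\cdot)$ is monotone nondecreasing; and for every $b>0$, $\Phi(\cdot,b)$ is monotone increasing on $[0,\infty)$. $\Phi$ is logarithmic with exponent $\gamma$ if for every $b>0$ there exist $\kappa_b>0$ and $a_b>0$ such that $\Phi(a,b)=\kappa_b\big(-\frac{1}{\ln(a)}\big)^\gamma$ for all $a\in(0,a_b)$. For a monotone increasing $f:[0,\infty)\to[0,\infty)$, $f^-(s):=\inf\{t\ge0: f(t)\ge s\}$ for $0\le s<\sup f$. For $\kappa>0$, $\phi_{\kappa,\Phi}(t):=(\Phi(\sqrt t,\kappa))^2$, $t\ge0$, and $\Phi^\spadesuit_\kappa(t):=\int_\delta^t\frac{1}{\phi^-_{\kappa,\Phi}(s)}\,ds$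 for $t\in(0,\sup\phi_{\kappa,\Phi})$, with $\delta\in(0,\sup\phi_{\kappa,\Phi})$ some fixed number; it is strictly increasing and continuous, with inverse $(\Phi^\spadesuit_\kappa)^{-1}$ defined on its range. $f(t)\sim g(t)$ as $t\to\infty$ means $\lim_{t\to\infty}f(t)/g(t)=1$. *)

(* Defs.v *)
From Stdlib Require Import Reals.
From Coquelicot Require Import Coquelicot.
Open Scope R_scope.

(* Functions on [0,oo) are represented by functions on R whose values at
   negative arguments are never used. *)

Record strict_error_bound (Phi : R -> R -> R) : Prop := {
  seb_nonneg : forall a b, 0 <= a -> 0 <= b -> 0 <= Phi a b;
  seb_mono_l : forall b, 0 <= b ->
    forall a1 a2, 0 <= a1 -> a1 <= a2 -> Phi a1 b <= Phi a2 b;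
  seb_rcont : forall b, 0 <= b ->
    filterlim (fun a => Phi a b) (at_right 0) (locally (Phi 0 b));
  seb_zero : forall b, 0 <= b -> Phi 0 b = 0;
  seb_mono_r : forall a, 0 <= a ->
    forall b1 b2, 0 <= b1 -> b1 <= b2 -> Phi a b1 <= Phi a b2;
  seb_strict : forall b, 0 < b ->
    forall a1 a2, 0 <= a1 -> a1 < a2 -> Phi a1 b < Phi a2 b
}.

(* [Rpower x y] is the real power only for [0 < x], that is for [a < 1] below;
   no strict error bound satisfies the formula on (0, a_b) with [a_b >= 1],
   since the right-hand side is unbounded as [a] tends to 1 from the left. *)
Definition logarithmic (Phi : R -> R -> R) (gamma : R) : Prop :=
  forall b, 0 < b ->
    exists kappa_b a_b, 0 < kappa_b /\ 0 < a_b /\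
      forall a, 0 < a < a_b ->
        Phi a b = kappa_b * Rpower (- (1 / ln a)) gamma.

Definition sup_nonneg (f : R -> R) : Rbar :=
  Lub_Rbar (fun y => exists t, 0 <= t /\ y = f t).

Definition gen_inv (f : R -> R) (s : R) : R :=
  real (Glb_Rbar (fun t => 0 <= t /\ s <= f t)).

Definition phi (kappa : R) (Phi : R -> R -> R) (t : R) : R :=
  (Phi (sqrt t) kappa) ^ 2.

(* [RInt] is oriented: for [t < delta] it is minus the integral from [t] to
   [delta]. *)
Definition Phi_spade (Phi : R -> R -> R) (kappa delta t : R) : R :=
  RInt (fun s => / gen_inv (phi kappa Phi) s) delta t.

(* [iota P] is the unique point satisfying [P].  When [y] is not in the range,
   [iota] returns a fixed default value that does not depend on [y]. *)
Definition Phi_spade_inv (Phi : R -> R -> R) (kappa delta y : R) : R :=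
  iota (fun t => 0 < t /\ Rbar_lt t (sup_nonneg (phi kappa Phi)) /\
                 Phi_spade Phi kappa delta t = y).

Definition asymp_equiv (f g : R -> R) : Prop :=
  is_lim (fun t => f t / g t) p_infty 1.

(* Main.v *)
Require Import Defs.
From Stdlib Require Import Reals Lra.
From Coquelicot Require Import Coquelicot.
Open Scope R_scope.

(** Write [w] for the reciprocal of the generalized inverse of
    [phi kappa Phi], and [S] for the supremum of [phi kappa Phi].  If
    [Phi a kappa = k * (- 1 / ln a) ^ gamma] near 0, then
    [phi kappa Phi t = k ^ 2 * (- 2 / ln t) ^ (2 * gamma)] near 0, and solving
    for [t] gives [w s = exp (c * s ^ (- p))] near 0, with
    [c = 2 * k ^ (1 / gamma)] and [p = 1 / (2 * gamma)]
    ([gen_inv_phi_near_0]).  On all of (0, S) the weight [w] is positive and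
    nonincreasing, and it is continuous because the generalized inverse of a
    strictly increasing function has no jumps ([gen_inv_continuous]).  These
    properties form the predicate [exp_singular]; the analysis uses nothing
    else about [Phi].

    The integral H(t) of [w] from [t] to [delta] need not be computed:
    monotonicity of [w] gives, for every [q > 1] and small [t],

      [(q - 1) * t * w (q * t) <= H t <= delta * w t].

    Since [t ^ p * ln t] tends to 0, taking logarithms and multiplying by
    [t ^ p] puts [t ^ p * ln (H t)] asymptotically between [c * q ^ (- p)] and
    [c]; as [q] is arbitrary, the limit at 0 is [c] ([es_ln_RInt]).

    The point [t] selected by the inverse at [- s] satisfies [H t = s] and
    tends to 0 as [s] grows, so [t ^ p * ln s] tends to [c]
    ([primitive_inv_equiv]).  Raising this to the power [gamma] turns
    [t ^ p] into [sqrt t], hence [sqrt t * (ln s) ^ gamma] tends to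
    [eta = c ^ gamma].  The two-sided bound follows from the equivalence. *)

(** * Generalized inverses of increasing functions *)

Definition increasing_nonneg (f : R -> R) : Prop :=
  forall x y, 0 <= x -> x < y -> f x < f y.

Lemma increasing_nonneg_le_reg (f : R -> R) (x y : R) :
  increasing_nonneg f -> 0 <= y -> f x <= f y -> x <= y.
Proof.
  intros Hf Hy Hxy.
  destruct (Rle_lt_dec x y) as [H | H]; [exact H |].
  specialize (Hf y x Hy H). lra.
Qed.

Lemma below_sup_reached (f : R -> R) (s : R) :
  Rbar_lt s (sup_nonneg f) -> exists t, 0 <= t /\ s < f t.
Proof.
  intros Hs.
  destruct (Classical_Prop.classic (exists t, 0 <= t /\ s < f t)) as [H | H]; [exact H |].
  exfalso.
  assert (Hle : Rbar_le (sup_nonneg f) s).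
  { apply (Lub_Rbar_correct (fun y => exists t, 0 <= t /\ y = f t)).
    intros y (t & Ht & ->).
    destruct (Rle_lt_dec (f t) s) as [H' | H']; [exact H' |].
    exfalso; apply H; exists t; auto. }
  exact (Rbar_lt_not_le _ _ Hs Hle).
Qed.

Lemma le_sup_nonneg (f : R -> R) (t : R) :
  0 <= t -> Rbar_le (f t) (sup_nonneg f).
Proof.
  intros Ht.
  apply (Lub_Rbar_correct (fun y => exists t, 0 <= t /\ y = f t)).
  exists t; auto.
Qed.

Lemma gen_inv_glb (f : R -> R) (s t : R) :
  0 <= t -> s <= f t ->
  is_glb_Rbar (fun t => 0 <= t /\ s <= f t) (gen_inv f s).
Proof.
  intros Ht Hs.
  assert (H := Glb_Rbar_correct (fun t => 0 <= t /\ s <= f t)).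
  unfold gen_inv.
  destruct (Glb_Rbar (fun t => 0 <= t /\ s <= f t)) as [l | |] eqn:E; simpl.
  - exact H.
  - destruct H as [H _]. exfalso. exact (H t (conj Ht Hs)).
  - destruct H as [_ H]. exfalso.
    apply (H (Finite 0)). intros x [Hx _]. exact Hx.
Qed.

Lemma gen_inv_le (f : R -> R) (s t : R) :
  0 <= t -> s <= f t -> gen_inv f s <= t.
Proof.
  intros Ht Hs. apply (gen_inv_glb f s t Ht Hs). auto.
Qed.

Lemma gen_inv_ge (f : R -> R) (s m : R) :
  Rbar_lt s (sup_nonneg f) ->
  (forall t, 0 <= t -> s <= f t -> m <= t) -> m <= gen_inv f s.
Proof.
  intros Hs Hm. destruct (below_sup_reached f s Hs) as (t & Ht & Hst).
  apply (proj2 (gen_inv_glb f s t Ht (Rlt_le _ _ Hst)) (Finite m)).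
  intros x [Hx Hfx]. exact (Hm x Hx Hfx).
Qed.

Lemma gen_inv_image (f : R -> R) (t : R) :
  increasing_nonneg f -> 0 <= t -> gen_inv f (f t) = t.
Proof.
  intros Hf Ht. apply Rle_antisym.
  - apply gen_inv_le; [exact Ht | apply Rle_refl].
  - apply gen_inv_ge.
    + apply Rbar_lt_le_trans with (f (t + 1)).
      * apply Hf; lra.
      * apply le_sup_nonneg; lra.
    + intros t' Ht' H. exact (increasing_nonneg_le_reg f t t' Hf Ht' H).
Qed.

Lemma gen_inv_mono (f : R -> R) (s1 s2 : R) :
  s1 <= s2 -> Rbar_lt s2 (sup_nonneg f) -> gen_inv f s1 <= gen_inv f s2.
Proof.
  intros H12 H2. apply gen_inv_ge; [exact H2 |].
  intros t Ht Hs. apply gen_inv_le; lra.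
Qed.

(** Jumps of [f] become plateaus of the inverse, whereas a jump of the inverse
    would be a plateau of [f], which strictness excludes. *)
Lemma gen_inv_continuous (f : R -> R) (s : R) :
  increasing_nonneg f -> Rbar_lt s (sup_nonneg f) -> continuous (gen_inv f) s.
Proof.
  intros Hf Hs.
  destruct (below_sup_reached f s Hs) as (T & HT & HsT).
  assert (H0 : 0 <= gen_inv f s).
  { apply gen_inv_ge; auto. }
  set (g := gen_inv f s) in *.
  assert (Habove : forall x, g < x -> s < f x).
  { intros x Hx. apply Rnot_le_lt; intro H.
    assert (Hlt : f ((g + x) / 2) < f x) by (apply Hf; lra).
    assert (Hge : x <= T) by (apply (increasing_nonneg_le_reg f); [exact Hf | lra | lra]).
    assert (Hgx : (g + x) / 2 <= g).
    { apply gen_inv_ge; [exact Hs |]. intros t Ht Hst.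
      apply (increasing_nonneg_le_reg f); [exact Hf | lra | lra]. }
    lra. }
  assert (Hbelow : forall x, 0 <= x -> x < g -> f x < s).
  { intros x Hx Hxg. apply Rnot_le_lt; intro H.
    assert (g <= x) by (apply gen_inv_le; auto). lra. }
  apply filterlim_locally. intros [eps Heps]; simpl.
  assert (Hup : locally s (fun y => gen_inv f y <= g + eps / 2)).
  { assert (Hlt : s < f (g + eps / 2)) by (apply Habove; lra).
    apply (filter_imp (fun y => y < f (g + eps / 2))).
    - intros y Hy. apply gen_inv_le; lra.
    - apply (open_lt (f (g + eps / 2))). exact Hlt. }
  assert (Hdown : locally s (fun y => g - eps / 2 <= gen_inv f y)).
  { assert (HT' : locally s (fun y => y < f T)) by (apply (open_lt (f T)); exact HsT).
    assert (Hsup : forall y, y < f T -> Rbar_lt y (sup_nonneg f)).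
    { intros y Hy. apply Rbar_lt_le_trans with (f T); [exact Hy | apply le_sup_nonneg; exact HT]. }
    destruct (Rle_lt_dec 0 (g - eps / 2)) as [Hd | Hd].
    - assert (Hlt : f (g - eps / 2) < s) by (apply Hbelow; lra).
      generalize (open_gt (f (g - eps / 2)) s Hlt). intros HO.
      apply (filter_imp (fun y => y < f T /\ f (g - eps / 2) < y)).
      + intros y [Hy1 Hy2]. apply gen_inv_ge; [apply Hsup; exact Hy1 |].
        intros t Ht Hyt. apply (increasing_nonneg_le_reg f); [exact Hf | exact Ht | lra].
      + apply filter_and; assumption.
    - apply (filter_imp (fun y => y < f T)); [| exact HT'].
      intros y Hy. apply gen_inv_ge; [apply Hsup; exact Hy |].
      intros t Ht _. lra. }
  generalize (filter_and _ _ Hup Hdown). apply filter_imp.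
  intros y [H1 H2]. change (Rabs (gen_inv f y - g) < eps).
  apply Rabs_def1; lra.
Qed.

(** * Primitives of weights with an exponential singularity at zero *)

(** Positivity makes the primitive injective, and monotonicity on the whole
    interval bounds the integral of [w] from above all the way up to [delta];
    the explicit form near 0 gives the asymptotics. *)
Record exp_singular (w : R -> R) (S : Rbar) (c p : R) : Prop := {
  es_cont : forall s, 0 < s -> Rbar_lt s S -> continuous w s;
  es_pos : forall s, 0 < s -> Rbar_lt s S -> 0 < w s;
  es_anti : forall s1 s2, 0 < s1 -> s1 <= s2 -> Rbar_lt s2 S -> w s2 <= w s1;
  es_near : exists s0, 0 < s0 /\
    forall s, 0 < s < s0 -> w s = exp (c * Rpower s (- p))
}.

Lemma Rbar_lt_of_le (x y : R) (S : Rbar) : x <= y -> Rbar_lt y S -> Rbar_lt x S.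
Proof.
  intros H1 H2. exact (Rbar_le_lt_trans (Finite x) (Finite y) S H1 H2).
Qed.

Lemma es_ex_RInt (w : R -> R) (S : Rbar) (c p a b : R) :
  exp_singular w S c p -> 0 < a -> Rbar_lt a S -> 0 < b -> Rbar_lt b S ->
  ex_RInt w a b.
Proof.
  intros Hw Ha HaS Hb HbS. apply (@ex_RInt_continuous R_CompleteNormedModule).
  intros z [Hz1 Hz2]. apply (es_cont _ _ _ _ Hw).
  - revert Hz1. unfold Rmin. destruct (Rle_dec a b); lra.
  - revert Hz2. unfold Rmax. destruct (Rle_dec a b); intro.
    + apply Rbar_lt_of_le with b; assumption.
    + apply Rbar_lt_of_le with a; assumption.
Qed.

Lemma es_RInt_pos (w : R -> R) (S : Rbar) (c p a b : R) :
  exp_singular w S c p -> 0 < a -> a < b -> Rbar_lt b S -> 0 < RInt w a b.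
Proof.
  intros Hw Ha Hab HbS.
  apply RInt_gt_0; [exact Hab | |]; intros x Hx.
  - apply (es_pos _ _ _ _ Hw); [lra |]. apply Rbar_lt_of_le with b; [lra | exact HbS].
  - apply (es_cont _ _ _ _ Hw); [lra |]. apply Rbar_lt_of_le with b; [lra | exact HbS].
Qed.

Lemma es_Chasles (w : R -> R) (S : Rbar) (c p x y z : R) :
  exp_singular w S c p -> 0 < x -> Rbar_lt x S -> 0 < y -> Rbar_lt y S ->
  0 < z -> Rbar_lt z S -> RInt w x y + RInt w y z = RInt w x z.
Proof.
  intros. apply (@RInt_Chasles R_CompleteNormedModule); eapply es_ex_RInt; eauto.
Qed.

Lemma es_RInt_le (w : R -> R) (S : Rbar) (c p a b : R) :
  exp_singular w S c p -> 0 < a -> a <= b -> Rbar_lt b S ->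
  RInt w a b <= (b - a) * w a.
Proof.
  intros Hw Ha Hab HbS.
  rewrite <- (RInt_const a b (w a) : _ = (b - a) * w a).
  apply RInt_le; [exact Hab | | apply ex_RInt_const |].
  - apply (es_ex_RInt w S c p); try assumption; [apply Rbar_lt_of_le with b; assumption | lra].
  - intros x Hx. apply (es_anti _ _ _ _ Hw); [lra | lra |].
    apply Rbar_lt_of_le with b; [lra | exact HbS].
Qed.

Lemma es_RInt_ge (w : R -> R) (S : Rbar) (c p a b : R) :
  exp_singular w S c p -> 0 < a -> a <= b -> Rbar_lt b S ->
  (b - a) * w b <= RInt w a b.
Proof.
  intros Hw Ha Hab HbS.
  rewrite <- (RInt_const a b (w b) : _ = (b - a) * w b).
  apply RInt_le; [exact Hab | apply ex_RInt_const | |].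
  - apply (es_ex_RInt w S c p); try assumption; [apply Rbar_lt_of_le with b; assumption | lra].
  - intros x Hx. apply (es_anti _ _ _ _ Hw); [lra | lra | exact HbS].
Qed.

Lemma filterlim_scal_ln_0 (p : R) :
  0 < p -> filterlim (fun t => p * ln t) (at_right 0) (Rbar_locally m_infty).
Proof.
  intros Hp.
  apply (filterlim_comp _ _ _ ln (fun x => p * x) _ (Rbar_locally m_infty)).
  - exact is_lim_ln_0.
  - assert (H := filterlim_Rbar_mult_l p m_infty).
    replace (Rbar_mult p m_infty) with m_infty in H; [exact H |].
    simpl. destruct (Rle_dec 0 p); [| exfalso; lra].
    destruct (Rle_lt_or_eq_dec 0 p r); [reflexivity | exfalso; lra].
Qed.

Lemma filterlim_Rpower_0 (p : R) :
  0 < p -> filterlim (fun t => Rpower t p) (at_right 0) (locally 0).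
Proof.
  intros Hp. unfold Rpower.
  apply (filterlim_comp _ _ _ (fun t => p * ln t) exp _ (Rbar_locally m_infty)).
  - exact (filterlim_scal_ln_0 p Hp).
  - exact is_lim_exp_m.
Qed.

(** With [y = p * ln t] the product is [y * exp y / p], and [y] tends to
    minus infinity. *)
Lemma filterlim_Rpower_ln_0 (p : R) :
  0 < p -> filterlim (fun t => Rpower t p * ln t) (at_right 0) (locally 0).
Proof.
  intros Hp. unfold Rpower.
  apply (filterlim_ext (fun t => / p * ((p * ln t) * exp (p * ln t)))).
  { intros t. field. lra. }
  replace 0 with (/ p * 0) at 2 by ring.
  apply (filterlim_comp _ _ _ (fun t => p * ln t * exp (p * ln t)) (fun x => / p * x) _ (locally 0)).
  2: apply (filterlim_scal_r (/ p) 0).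
  apply (filterlim_comp _ _ _ (fun t => p * ln t) (fun y => y * exp y) _ (Rbar_locally m_infty)).
  - exact (filterlim_scal_ln_0 p Hp).
  - exact is_lim_mul_exp_m.
Qed.

Lemma at_right_0_lt (m : R) : 0 < m -> at_right 0 (fun t => 0 < t < m).
Proof.
  intros Hm. unfold at_right, within.
  apply (filter_imp (fun t => t < m)); [intros t H1 H2; lra |].
  apply (open_lt m). exact Hm.
Qed.

Lemma Rpower_inv_exponent (x p : R) : 0 < x -> p <> 0 -> Rpower (Rpower x (/ p)) p = x.
Proof.
  intros Hx Hp. rewrite Rpower_mult.
  replace (/ p * p) with 1 by (field; exact Hp).
  apply Rpower_1; exact Hx.
Qed.

Lemma ln_le_compat (x y : R) : 0 < x -> x <= y -> ln x <= ln y.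
Proof.
  intros Hx [H | ->]; [left; apply ln_increasing; assumption | right; reflexivity].
Qed.

(** The squeeze behind the theorem: the integral exceeds that over the short
    interval [[t, q * t]], where [w >= w (q * t)], and is at most
    [delta * w t].  The polynomial factors [(q - 1) * t] and [delta] disappear
    after taking logarithms and multiplying by [t ^ p]. *)
Lemma es_ln_RInt (w : R -> R) (S : Rbar) (c p delta : R) :
  exp_singular w S c p -> 0 < c -> 0 < p -> 0 < delta -> Rbar_lt delta S ->
  filterlim (fun t => Rpower t p * ln (RInt w t delta)) (at_right 0) (locally c).
Proof.
  intros Hw Hc Hp Hd HdS.
  destruct (es_near _ _ _ _ Hw) as (s0 & Hs0 & Hnear).
  apply filterlim_locally. intros [eps Heps]; simpl.
  (* The lower bound tends to [c * q ^ (- p)]; [q] is chosen so that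
     [lam = q ^ (- p)] brings this within [eps / 2] of [c]. *)
  set (lam := c / (c + eps / 2)).
  assert (Hlam : 0 < lam < 1).
  { unfold lam; split; [apply Rdiv_lt_0_compat; lra |].
    apply Rlt_div_l; lra. }
  assert (Hclam : c - eps / 2 <= c * lam).
  { assert (Hl : lam * (c + eps / 2) = c) by (unfold lam; field; lra). nra. }
  set (q := Rpower (/ lam) (/ p)).
  assert (Hlam1 : 1 < / lam) by (rewrite <- Rinv_1; apply Rinv_lt_contravar; lra).
  assert (Hq : 1 < q).
  { rewrite <- (Rpower_O (/ lam)) by lra. apply Rpower_lt; [exact Hlam1 |].
    apply Rinv_0_lt_compat; exact Hp. }
  assert (Hqp : Rpower q p = / lam) by (apply Rpower_inv_exponent; lra).
  assert (Hlow : filterlim (fun t => ln (q - 1) * Rpower t p + Rpower t p * ln t)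
            (at_right 0) (locally 0)).
  { replace 0 with (ln (q - 1) * 0 + 0) at 2 by ring.
    apply (filterlim_comp_2 (F := at_right 0) (G := locally (ln (q - 1) * 0)) (H := locally 0)
             _ _ Rplus).
    - apply (filterlim_comp _ _ _ _ (fun x => ln (q - 1) * x) _ (locally 0)).
      + apply filterlim_Rpower_0; exact Hp.
      + apply (filterlim_scal_r (ln (q - 1)) 0).
    - apply filterlim_Rpower_ln_0; exact Hp.
    - apply (filterlim_plus (ln (q - 1) * 0) 0). }
  assert (Hup : filterlim (fun t => ln delta * Rpower t p) (at_right 0) (locally 0)).
  { replace 0 with (ln delta * 0) at 2 by ring.
    apply (filterlim_comp _ _ _ _ (fun x => ln delta * x) _ (locally 0)).
    + apply filterlim_Rpower_0; exact Hp.
    + apply (filterlim_scal_r (ln delta) 0). }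
  assert (Heps2 : 0 < eps / 2) by lra.
  generalize (proj1 (filterlim_locally _ _) Hlow (mkposreal _ Heps2)); intro Elow.
  generalize (proj1 (filterlim_locally _ _) Hup (mkposreal _ Heps2)); intro Eup.
  assert (Em : at_right 0 (fun t => 0 < t < Rmin delta s0 / q)).
  { apply at_right_0_lt. apply Rdiv_lt_0_compat; [| lra].
    unfold Rmin; destruct (Rle_dec delta s0); lra. }
  generalize (filter_and _ _ (filter_and _ _ Elow Eup) Em). apply filter_imp.
  intros t [[H1 H2] [Ht Htm]].
  change (Rabs (ln (q - 1) * Rpower t p + Rpower t p * ln t - 0) < eps / 2) in H1.
  change (Rabs (ln delta * Rpower t p - 0) < eps / 2) in H2.
  change (Rabs (Rpower t p * ln (RInt w t delta) - c) < eps).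
  apply Rabs_def2 in H1. apply Rabs_def2 in H2.
  assert (Hqt : q * t < Rmin delta s0).
  { apply Rlt_div_r in Htm; lra. }
  assert (Hqt1 := Rmin_l delta s0). assert (Hqt2 := Rmin_r delta s0).
  assert (Htq : t < q * t) by nra.
  assert (HqtS : Rbar_lt (q * t) S) by (apply Rbar_lt_of_le with delta; [lra | exact HdS]).
  assert (HtS : Rbar_lt t S) by (apply Rbar_lt_of_le with delta; [lra | exact HdS]).
  set (P := Rpower t p) in *.
  assert (HP : 0 < P) by apply exp_pos.
  assert (HPt : Rpower t (- p) = / P) by apply Rpower_Ropp.
  assert (HI : 0 < RInt w t delta) by (apply (es_RInt_pos w S c p); auto; lra).
  assert (Hge : (q - 1) * t * exp (c * (lam * / P)) <= RInt w t delta).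
  { rewrite <- (es_Chasles w S c p t (q * t) delta Hw) by (assumption || lra).
    assert (0 < RInt w (q * t) delta) by (apply (es_RInt_pos w S c p); auto; lra).
    assert (Hle := es_RInt_ge w S c p t (q * t) Hw Ht (Rlt_le _ _ Htq) HqtS).
    rewrite Hnear in Hle by lra.
    rewrite <- Rpower_mult_distr in Hle by lra.
    rewrite HPt, Rpower_Ropp, Hqp, Rinv_inv in Hle. lra. }
  assert (Hle : RInt w t delta <= delta * exp (c * / P)).
  { assert (H := es_RInt_le w S c p t delta Hw Ht ltac:(lra) HdS).
    rewrite Hnear, HPt in H by lra.
    assert (0 < exp (c * / P)) by apply exp_pos. nra. }
  apply ln_le_compat in Hge.
  2: { apply Rmult_lt_0_compat; [nra | apply exp_pos]. }
  apply ln_le_compat in Hle; [| exact HI].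
  rewrite ln_mult, ln_mult, ln_exp in Hge; [| lra | lra | nra | apply exp_pos].
  rewrite ln_mult, ln_exp in Hle; [| lra | apply exp_pos].
  apply (Rmult_le_compat_l P) in Hge; [| lra].
  apply (Rmult_le_compat_l P) in Hle; [| lra].
  replace (P * (ln delta + c * / P)) with (ln delta * P + c) in Hle by (field; lra).
  replace (P * (ln (q - 1) + ln t + c * (lam * / P)))
    with (ln (q - 1) * P + P * ln t + c * lam) in Hge by (field; lra).
  apply Rabs_def1; lra.
Qed.

(** Without this the primitive would not take every large negative value, and
    the inverse at such a value would be an arbitrary default. *)
Lemma es_RInt_unbounded (w : R -> R) (S : Rbar) (c p delta M : R) :
  exp_singular w S c p -> 0 < c -> 0 < p -> 0 < delta -> Rbar_lt delta S ->
  exists t, 0 < t < delta /\ M < RInt w t delta.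
Proof.
  intros Hw Hc Hp Hd HdS.
  assert (Hc2 : 0 < c / 2) by lra.
  set (M' := Rmax M 1).
  assert (HM : M <= M') by apply Rmax_l.
  assert (HM' : 1 <= M') by apply Rmax_r.
  assert (Hr : 0 < c / 2 / M') by (apply Rdiv_lt_0_compat; lra).
  generalize (proj1 (filterlim_locally _ _) (es_ln_RInt w S c p delta Hw Hc Hp Hd HdS)
    (mkposreal _ Hc2)); intro E1.
  generalize (proj1 (filterlim_locally _ _) (filterlim_Rpower_0 p Hp) (mkposreal _ Hr)); intro E2.
  destruct (filter_ex _ (filter_and _ _ (filter_and _ _ E1 E2) (at_right_0_lt delta Hd)))
    as (t & [H1 H2] & Ht).
  exists t. split; [exact Ht |].
  change (Rabs (Rpower t p * ln (RInt w t delta) - c) < c / 2) in H1.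
  change (Rabs (Rpower t p - 0) < c / 2 / M') in H2.
  apply Rabs_def2 in H1. apply Rabs_def2 in H2.
  assert (HI : 0 < RInt w t delta) by (apply (es_RInt_pos w S c p); auto; lra).
  assert (HP : 0 < Rpower t p) by apply exp_pos.
  assert (HPM : Rpower t p * M' < c / 2).
  { apply Rlt_div_r; lra. }
  assert (HlnM : M' < ln (RInt w t delta)) by (apply Rnot_le_lt; intro; nra).
  assert (Hexp := exp_ineq1_le (ln (RInt w t delta))).
  rewrite exp_ln in Hexp by exact HI. lra.
Qed.

(** For [w] the reciprocal of [gen_inv (phi kappa Phi)] and [S] the supremum of
    [phi kappa Phi], this is convertible to [Phi_spade_inv Phi kappa delta]. *)
Definition primitive_inv (w : R -> R) (S : Rbar) (delta y : R) : R :=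
  iota (fun t => 0 < t /\ Rbar_lt t S /\ RInt w delta t = y).

Lemma es_RInt_swap (w : R -> R) (S : Rbar) (c p a b : R) :
  exp_singular w S c p -> 0 < a -> Rbar_lt a S -> 0 < b -> Rbar_lt b S ->
  RInt w b a = - RInt w a b.
Proof.
  intros. symmetry. apply (@opp_RInt_swap R_CompleteNormedModule).
  eapply es_ex_RInt; eauto.
Qed.

Lemma es_primitive_increasing (w : R -> R) (S : Rbar) (c p delta x y : R) :
  exp_singular w S c p -> 0 < delta -> Rbar_lt delta S ->
  0 < x -> x < y -> Rbar_lt y S -> RInt w delta x < RInt w delta y.
Proof.
  intros Hw Hd HdS Hx Hxy HyS.
  assert (HxS : Rbar_lt x S) by (apply Rbar_lt_of_le with y; [lra | exact HyS]).
  rewrite <- (es_Chasles w S c p delta x y Hw) by (assumption || lra).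
  assert (0 < RInt w x y) by (apply (es_RInt_pos w S c p); assumption).
  lra.
Qed.

Lemma es_primitive_continuity (w : R -> R) (S : Rbar) (c p delta x : R) :
  exp_singular w S c p -> 0 < delta -> Rbar_lt delta S ->
  0 < x -> Rbar_lt x S -> continuity_pt (RInt w delta) x.
Proof.
  intros Hw Hd HdS Hx HxS. apply continuity_pt_filterlim.
  apply (continuous_RInt_1 w delta x (RInt w delta)).
  apply (filter_imp (fun z => 0 < z /\ Rbar_lt z S)).
  - intros z [Hz HzS]. apply (@RInt_correct R_CompleteNormedModule).
    eapply es_ex_RInt; eauto.
  - apply filter_and; [apply (open_gt 0); exact Hx |].
    exact (open_Rbar_lt' x S HxS).
Qed.

(** The intermediate value theorem provides a preimage of [- s] to the left of
    [delta], and strict monotonicity of the primitive makes it unique. *)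
Lemma primitive_inv_spec (w : R -> R) (S : Rbar) (c p delta s : R) :
  exp_singular w S c p -> 0 < c -> 0 < p -> 0 < delta -> Rbar_lt delta S ->
  0 < s ->
  let t := primitive_inv w S delta (- s) in
  0 < t /\ Rbar_lt t S /\ RInt w delta t = - s.
Proof.
  intros Hw Hc Hp Hd HdS Hs t.
  apply (iota_correct (fun t => 0 < t /\ Rbar_lt t S /\ RInt w delta t = - s)).
  destruct (es_RInt_unbounded w S c p delta s Hw Hc Hp Hd HdS) as (a & Ha & HaI).
  assert (HaS : Rbar_lt a S) by (apply Rbar_lt_of_le with delta; [lra | exact HdS]).
  destruct (Ranalysis5.IVT_interv (fun x => RInt w delta x + s) a delta) as (z & Hz & Hzs).
  - intros x Hx. apply continuity_pt_plus.
    + apply (es_primitive_continuity w S c p); try assumption; [lra |].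
      apply Rbar_lt_of_le with delta; [lra | exact HdS].
    + apply continuity_pt_const. intros ? ?; reflexivity.
  - lra.
  - rewrite (es_RInt_swap w S c p a delta Hw) by (assumption || lra). lra.
  - rewrite RInt_point. change (0 < 0 + s). lra.
  - assert (HzS : Rbar_lt z S) by (apply Rbar_lt_of_le with delta; [lra | exact HdS]).
    exists z. split.
    + split; [lra |]. split; [exact HzS | lra].
    + intros y (Hy & HyS & HyI).
      destruct (Rtotal_order z y) as [H | [H | H]]; [| exact H |].
      * assert (H' := es_primitive_increasing w S c p delta z y Hw Hd HdS ltac:(lra) H HyS). lra.
      * assert (H' := es_primitive_increasing w S c p delta y z Hw Hd HdS Hy H HzS). lra.
Qed.

(** The primitive increases, so any [s] larger than the integral from [e] to
    [delta] has its preimage below [e]. *)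
Lemma primitive_inv_at_right_0 (w : R -> R) (S : Rbar) (c p delta : R) :
  exp_singular w S c p -> 0 < c -> 0 < p -> 0 < delta -> Rbar_lt delta S ->
  filterlim (fun s => primitive_inv w S delta (- s)) (Rbar_locally p_infty) (at_right 0).
Proof.
  intros Hw Hc Hp Hd HdS P [eps HP].
  set (e := Rmin eps delta).
  assert (He : 0 < e) by (unfold e; apply Rmin_glb_lt; [apply cond_pos | exact Hd]).
  assert (HeS : Rbar_lt e S).
  { apply Rbar_lt_of_le with delta; [apply Rmin_r | exact HdS]. }
  exists (Rmax 0 (RInt w e delta)). intros s Hs.
  assert (H1 := Rmax_l 0 (RInt w e delta)). assert (H2 := Rmax_r 0 (RInt w e delta)).
  destruct (primitive_inv_spec w S c p delta s Hw Hc Hp Hd HdS ltac:(lra)) as (Ht & HtS & HtI).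
  set (t := primitive_inv w S delta (- s)) in *.
  apply HP; [| exact Ht].
  assert (Hte : t < e).
  { apply Rnot_le_lt. intros [H | H].
    - assert (H' := es_primitive_increasing w S c p delta e t Hw Hd HdS He H HtS).
      rewrite (es_RInt_swap w S c p e delta Hw) in H' by (assumption || lra). lra.
    - rewrite <- H in HtI.
      rewrite (es_RInt_swap w S c p e delta Hw) in HtI by (assumption || lra). lra. }
  assert (Hee : e <= eps) by apply Rmin_l.
  change (Rabs (t - 0) < eps). rewrite Rminus_0_r, Rabs_pos_eq; lra.
Qed.

Lemma primitive_inv_equiv (w : R -> R) (S : Rbar) (c p delta : R) :
  exp_singular w S c p -> 0 < c -> 0 < p -> 0 < delta -> Rbar_lt delta S ->
  filterlim (fun s => Rpower (primitive_inv w S delta (- s)) p * ln s)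
    (Rbar_locally p_infty) (locally c).
Proof.
  intros Hw Hc Hp Hd HdS.
  apply (filterlim_ext_loc (fun s =>
    Rpower (primitive_inv w S delta (- s)) p * ln (RInt w (primitive_inv w S delta (- s)) delta))).
  - exists 0. intros s Hs.
    destruct (primitive_inv_spec w S c p delta s Hw Hc Hp Hd HdS Hs) as (Ht & HtS & HtI).
    rewrite (es_RInt_swap w S c p delta) by assumption.
    rewrite HtI, Ropp_involutive. reflexivity.
  - apply (filterlim_comp _ _ _ (fun s => primitive_inv w S delta (- s))
      (fun t => Rpower t p * ln (RInt w t delta)) _ (at_right 0)).
    + apply (primitive_inv_at_right_0 w S c p); assumption.
    + apply (es_ln_RInt w S c p); assumption.
Qed.

(** * Logarithmic error bounds *)

Lemma phi_increasing (kappa : R) (Phi : R -> R -> R) :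
  0 < kappa -> strict_error_bound Phi -> increasing_nonneg (phi kappa Phi).
Proof.
  intros Hk HPhi x y Hx Hxy. unfold phi.
  assert (Hs : sqrt x < sqrt y) by (apply sqrt_lt_1; lra).
  assert (H0 : 0 <= sqrt x) by apply sqrt_pos.
  assert (H1 := seb_strict Phi HPhi kappa Hk (sqrt x) (sqrt y) H0 Hs).
  assert (H2 := seb_nonneg Phi HPhi (sqrt x) kappa H0 (Rlt_le _ _ Hk)).
  nra.
Qed.

(** The exponential on the right is the [t] with [phi kappa Phi t = s]: its
    square root is [exp (- K / s ^ p)] with [K = k ^ (1 / gamma)], and applying
    the logarithmic formula there gives [sqrt s], as long as that square root
    is below [a0]. *)
Lemma gen_inv_phi_near_0 (kappa gamma k a0 : R) (Phi : R -> R -> R) :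
  0 < kappa -> 0 < gamma -> strict_error_bound Phi -> 0 < k -> 0 < a0 ->
  (forall a, 0 < a < a0 -> Phi a kappa = k * Rpower (- (1 / ln a)) gamma) ->
  exists s0, 0 < s0 /\ forall s, 0 < s < s0 ->
    gen_inv (phi kappa Phi) s =
      exp (- (2 * Rpower k (/ gamma) * Rpower s (- / (2 * gamma)))).
Proof.
  intros Hk Hg HPhi Hk0 Ha0 Hlog.
  set (K := Rpower k (/ gamma)).
  assert (HK : 0 < K) by apply exp_pos.
  set (p := / (2 * gamma)).
  assert (Hp : 0 < p) by (apply Rinv_0_lt_compat; lra).
  (* This bound on [s ^ p] forces [K / s ^ p > - ln a0], that is
     [exp (- K / s ^ p) < a0]; the maximum with 1 keeps it positive when
     [a0 >= 1]. *)
  assert (Hm : 0 < K / Rmax 1 (- ln a0)).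
  { apply Rdiv_lt_0_compat; [exact HK |]. assert (H := Rmax_l 1 (- ln a0)). lra. }
  generalize (proj1 (filterlim_locally _ _) (filterlim_Rpower_0 p Hp) (mkposreal _ Hm)).
  intros [[e He] HE]. exists e. split; [exact He |]. intros s Hs.
  assert (HsP : Rpower s p < K / Rmax 1 (- ln a0)).
  { assert (H := HE s). simpl in H.
    assert (Hb : Rabs (Rpower s p - 0) < K / Rmax 1 (- ln a0)).
    { apply H; [| lra]. change (Rabs (s - 0) < e). rewrite Rminus_0_r, Rabs_pos_eq; lra. }
    apply Rabs_def2 in Hb. lra. }
  set (Q := Rpower s p) in *.
  assert (HQ : 0 < Q) by apply exp_pos.
  assert (HsQ : Rpower s (- p) = / Q) by apply Rpower_Ropp.
  rewrite HsQ.
  set (t := exp (- (2 * K * / Q))).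
  assert (Ht : sqrt t = exp (- (K / Q))).
  { rewrite <- (sqrt_pow2 (exp (- (K / Q)))) by (left; apply exp_pos).
    f_equal. unfold t. simpl. rewrite Rmult_1_r, <- exp_plus. f_equal. field. lra. }
  assert (Hta : exp (- (K / Q)) < a0).
  { rewrite <- (exp_ln a0) by exact Ha0. apply exp_increasing.
    assert (H1 := Rmax_l 1 (- ln a0)). assert (H2 := Rmax_r 1 (- ln a0)).
    assert (Rmax 1 (- ln a0) < K / Q); [| lra].
    apply Rlt_div_r; [exact HQ |]. apply Rlt_div_r in HsP; lra. }
  assert (Hphi : phi kappa Phi t = s).
  { unfold phi. rewrite Ht, Hlog by (split; [apply exp_pos | exact Hta]).
    rewrite ln_exp.
    replace (- (1 / - (K / Q))) with (/ K * Q) by (field; lra).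
    rewrite <- Rpower_mult_distr; [| apply Rinv_0_lt_compat; exact HK | exact HQ].
    unfold K, Q. rewrite <- Rpower_Ropp, !Rpower_mult.
    replace (- / gamma * gamma) with (- (1)) by (field; lra).
    replace (p * gamma) with (/ 2) by (unfold p; field; lra).
    rewrite Rpower_Ropp, Rpower_1 by exact Hk0.
    rewrite Rpower_sqrt by lra.
    replace (k * (/ k * sqrt s)) with (sqrt s) by (field; lra).
    apply pow2_sqrt. lra. }
  rewrite <- Hphi at 1. apply gen_inv_image.
  - apply phi_increasing; assumption.
  - left; apply exp_pos.
Qed.

Lemma inv_gen_inv_phi_exp_singular (kappa gamma k a0 : R) (Phi : R -> R -> R) :
  0 < kappa -> 0 < gamma -> strict_error_bound Phi -> 0 < k -> 0 < a0 ->
  (forall a, 0 < a < a0 -> Phi a kappa = k * Rpower (- (1 / ln a)) gamma) ->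
  exp_singular (fun s => / gen_inv (phi kappa Phi) s) (sup_nonneg (phi kappa Phi))
    (2 * Rpower k (/ gamma)) (/ (2 * gamma)).
Proof.
  intros Hk Hg HPhi Hk0 Ha0 Hlog.
  destruct (gen_inv_phi_near_0 kappa gamma k a0 Phi Hk Hg HPhi Hk0 Ha0 Hlog)
    as (s0 & Hs0 & Hnear).
  (* The generalized inverse is monotone, so it suffices that it is an
     exponential, hence positive, near 0. *)
  assert (Hpos : forall s, 0 < s -> Rbar_lt s (sup_nonneg (phi kappa Phi)) ->
            0 < gen_inv (phi kappa Phi) s).
  { intros s Hs HsS. set (r := Rmin s (s0 / 2)).
    assert (Hr : 0 < r) by (apply Rmin_glb_lt; lra).
    apply Rlt_le_trans with (gen_inv (phi kappa Phi) r).
    - assert (r <= s0 / 2) by apply Rmin_r.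
      rewrite Hnear by lra. apply exp_pos.
    - apply gen_inv_mono; [apply Rmin_l | exact HsS]. }
  split.
  - intros s Hs HsS. apply (continuous_comp (gen_inv (phi kappa Phi)) Rinv).
    + apply gen_inv_continuous; [apply phi_increasing; assumption | exact HsS].
    + apply continuous_Rinv. apply Rgt_not_eq. exact (Hpos s Hs HsS).
  - intros s Hs HsS. apply Rinv_0_lt_compat. exact (Hpos s Hs HsS).
  - intros s1 s2 H1 H12 H2. apply Rinv_le_contravar.
    + apply Hpos; [exact H1 | apply Rbar_lt_of_le with s2; assumption].
    + apply gen_inv_mono; assumption.
  - exists s0. split; [exact Hs0 |]. intros s Hs.
    rewrite Hnear by exact Hs. rewrite exp_Ropp, Rinv_inv. reflexivity.
Qed.

Lemma asymp_equiv_two_sided (f g : R -> R) (eta : R) :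
  (forall s, 0 < g s) -> 0 < eta -> asymp_equiv f (fun s => eta * g s) ->
  exists eta1 eta2 N, 0 < eta1 /\ 0 < eta2 /\ 0 < N /\
    forall s, N <= s -> eta1 * g s <= f s <= eta2 * g s.
Proof.
  intros Hg Heta Hfg.
  destruct (proj1 (filterlim_locally _ _) Hfg (mkposreal (1 / 2) ltac:(lra))) as [M HM].
  exists (eta / 2), (2 * eta), (Rmax 0 M + 1).
  assert (H0 := Rmax_l 0 M). assert (H1 := Rmax_r 0 M).
  split; [lra | split; [lra | split; [lra |]]].
  intros s Hs. specialize (HM s ltac:(lra)). specialize (Hg s).
  change (Rabs (f s / (eta * g s) - 1) < 1 / 2) in HM.
  apply Rabs_def2 in HM.
  assert (Heg : 0 < eta * g s) by nra.
  replace (f s) with (f s / (eta * g s) * (eta * g s)) by (field; lra).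
  set (r := f s / (eta * g s)) in *. nra.
Qed.

Theorem theorem5p12 :
  forall (kappa gamma delta : R) (Phi : R -> R -> R),
    0 < kappa ->
    0 < gamma ->
    strict_error_bound Phi ->
    logarithmic Phi gamma ->
    0 < delta ->
    Rbar_lt delta (sup_nonneg (phi kappa Phi)) ->
    (exists eta : R, 0 < eta /\
       asymp_equiv (fun s => sqrt (Phi_spade_inv Phi kappa delta (- s)))
                   (fun s => eta * Rpower (1 / ln s) gamma)) /\
    (exists eta1 eta2 N : R, 0 < eta1 /\ 0 < eta2 /\ 0 < N /\
       forall s : R, N <= s ->
         eta1 * Rpower (1 / ln s) gamma
           <= sqrt (Phi_spade_inv Phi kappa delta (- s))
           <= eta2 * Rpower (1 / ln s) gamma).
Proof.
  intros kappa gamma delta Phi Hk Hg HPhi Hlog Hd HdS.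
  destruct (Hlog kappa Hk) as (k & a0 & Hk0 & Ha0 & Hloga).
  assert (Hw := inv_gen_inv_phi_exp_singular kappa gamma k a0 Phi Hk Hg HPhi Hk0 Ha0 Hloga).
  set (c := 2 * Rpower k (/ gamma)) in Hw. set (p := / (2 * gamma)) in Hw.
  assert (Hc : 0 < c) by (apply Rmult_lt_0_compat; [lra | apply exp_pos]).
  assert (Hp : 0 < p) by (apply Rinv_0_lt_compat; lra).
  assert (Hequiv : asymp_equiv (fun s => sqrt (Phi_spade_inv Phi kappa delta (- s)))
                   (fun s => Rpower c gamma * Rpower (1 / ln s) gamma)).
  { assert (Hlim := primitive_inv_equiv _ _ c p delta Hw Hc Hp Hd HdS).
    change (filterlim (fun s => sqrt (Phi_spade_inv Phi kappa delta (- s)) /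
      (Rpower c gamma * Rpower (1 / ln s) gamma)) (Rbar_locally p_infty) (locally 1)).
    apply (filterlim_ext_loc (fun s =>
      / Rpower c gamma * Rpower (Rpower (Phi_spade_inv Phi kappa delta (- s)) p * ln s) gamma)).
    - exists 1. intros s Hs.
      destruct (primitive_inv_spec _ _ c p delta s Hw Hc Hp Hd HdS ltac:(lra)) as (Ht & _ & _).
      change (0 < Phi_spade_inv Phi kappa delta (- s)) in Ht.
      assert (Hln : 0 < ln s) by (rewrite <- ln_1; apply ln_increasing; lra).
      rewrite <- Rpower_mult_distr; [| apply exp_pos | exact Hln].
      rewrite Rpower_mult. replace (p * gamma) with (/ 2) by (unfold p; field; lra).
      rewrite Rpower_sqrt by exact Ht.
      replace (Rpower (1 / ln s) gamma) with (/ Rpower (ln s) gamma).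
      + field. split; apply Rgt_not_eq; apply exp_pos.
      + rewrite <- Rpower_Ropp. unfold Rpower. f_equal.
        replace (1 / ln s) with (/ ln s) by (field; lra).
        rewrite ln_Rinv by exact Hln. ring.
    - replace 1 with (/ Rpower c gamma * Rpower c gamma)
        by (apply Rinv_l; apply Rgt_not_eq; apply exp_pos).
      apply (filterlim_comp _ _ _ _ (fun x => / Rpower c gamma * Rpower x gamma) _ (locally c) _ Hlim).
      apply (continuous_scal_r (/ Rpower c gamma) (fun x => Rpower x gamma) c).
      apply continuity_pt_filterlim. apply derivable_continuous_pt.
      eexists. apply derivable_pt_lim_power. exact Hc. }
  assert (Heta : 0 < Rpower c gamma) by apply exp_pos.
  split.
  - exists (Rpower c gamma). split; assumption.
  - apply (asymp_equiv_two_sided (fun s => sqrt (Phi_spade_inv Phi kappa delta (- s)))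
      (fun s => Rpower (1 / ln s) gamma) (Rpower c gamma)); try assumption.
    intros s. apply exp_pos.
Qed.
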